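(* For any $(\tilde\alpha,\tilde\beta,e)\in\mathcal R_{NH}\cup\mathcal R_{EH}$, every $1$-degenerate surface has even geometric multiplicity; that is, $\nu_1(\tilde\xi_{\tilde\alpha,\tilde\beta,e})=\dim\ker(\tilde\xi_{\tilde\alpha,\tilde\beta,e}(2\pi)-I_4)$ is even.
   Context: $\xi_{\alpha,\beta,e}$ is the fundamental solution ($\xi(0)=I_4$) on $[0,2\pi]$ of $\xi'=J\begin{pmatrix}1&0&0&1\\0&1&-1&0\\0&-1&1-\frac{1+\alpha+3\beta}{1+e\cos t}&0\\1&0&0&1-\frac{1+\alpha-3\beta}{1+e\cos t}\end{pmatrix}\xi$; with $\tilde\alpha=\alpha-\beta$, $\tilde\beta=-\alpha+3\beta-1$, $\tilde\xi_{\tilde\alpha,\tilde\beta,e}:=\xi_{\alpha,\beta,e}$. $\mathcal R_{NH}=\{-1<\tilde\beta<0,\tilde\alpha>0,e\in[0,1)\}$, $\mathcal R_{EH}=\{\tilde\beta>0,\tilde\alpha>0,e\in[0,1)\}$. Equivalently, the kernel of $\mathcal A(\alpha,\beta,e)=-\frac{d^2}{dt^2}I_2-I_2+\frac{1}{1+e\cos t}((1+\alpha)I_2+3\beta S(t))$, $S(t)=\begin{pmatrix}\cos2t&\sin2t\\\sin2t&-\cos2t\end{pmatrix}$, on $2\pi$-periodic $W^{2,2}$ functions has even dimension. *)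

(* Defs.v *)
From HB Require Import structures.
From mathcomp Require Import all_boot all_order all_algebra.
From mathcomp Require Import all_classical all_reals all_analysis.
Set Implicit Arguments. Unset Strict Implicit. Unset Printing Implicit Defensive.
Import Order.TTheory GRing.Theory Num.Theory.
Local Open Scope ring_scope.

Definition Jmx (R : realType) : 'M[R]_4 :=
  \matrix_(i < 4, j < 4)
    match nat_of_ord i, nat_of_ord j with
    | 0%N, 2%N => -1 | 1%N, 3%N => -1
    | 2%N, 0%N => 1  | 3%N, 1%N => 1
    | _, _ => 0
    end.

Definition Bmx (R : realType) (a b e t : R) : 'M[R]_4 :=
  \matrix_(i < 4, j < 4)
    match nat_of_ord i, nat_of_ord j with
    | 0%N, 0%N => 1 | 0%N, 3%N => 1
    | 1%N, 1%N => 1 | 1%N, 2%N => -1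
    | 2%N, 1%N => -1 | 2%N, 2%N => 1 - (1 + a + 3 * b) / (1 + e * cos t)
    | 3%N, 0%N => 1 | 3%N, 3%N => 1 - (1 + a - 3 * b) / (1 + e * cos t)
    | _, _ => 0
    end.

(* xi is the fundamental solution: xi(0) = I_4 and xi' = J B(t) xi
   (entrywise derivative).  The coefficients are smooth on all of R when
   0 <= e < 1, so the solution on [0, 2pi] is the restriction of the global one. *)
Definition fundamental_solution (R : realType) (a b e : R) (xi : R -> 'M[R]_4) :=
  xi 0 = 1%:M /\
  forall (t : R) (i j : 'I_4),
    is_derive t 1 (fun s => xi s i j) ((Jmx R *m Bmx a b e t *m xi t) i j).

(* Geometric multiplicity of the eigenvalue 1 of a 4x4 matrix M:
   dim ker (M - I_4) (column kernel, computed as the row kernel of the transpose). *)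
Definition nu1 (R : realType) (M : 'M[R]_4) : nat :=
  \rank (kermx ((M - 1%:M)^T)).

Definition R_NH (R : realType) (ta tb e : R) : Prop :=
  -1 < tb /\ tb < 0 /\ 0 < ta /\ 0 <= e /\ e < 1.
Definition R_EH (R : realType) (ta tb e : R) : Prop :=
  0 < tb /\ 0 < ta /\ 0 <= e /\ e < 1.

(* Main.v *)
Require Import Defs.
From HB Require Import structures.
From mathcomp Require Import all_boot all_order all_algebra.
From mathcomp Require Import all_classical all_reals all_analysis.
From mathcomp Require Import ring lra.
Import Order.TTheory GRing.Theory Num.Theory.
Import numFieldNormedType.Exports.
Local Open Scope classical_set_scope.
Local Open Scope ring_scope.

(* The last two components [x, y] of a solution satisfy
   [(1 + e cos t) (x'' - 2 y') = p x] and [(1 + e cos t) (y'' + 2 x') = q y] with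
   [p = 1 + alpha + 3 beta] and [q = 1 + alpha - 3 beta], both nonzero in the two regions.  For
   [2 pi]-periodic solutions these equations are recurrences on the Fourier coefficients, and in
   positive frequency they are invariant under harmonic conjugation [cos nt -> sin nt],
   [sin nt -> - cos nt]: frequency 0 does not enter, since [x'' - 2 y'] and [y'' + 2 x'] have mean
   zero.  The frequency-0 equations only determine the means of [x] and [y], because [p] and [q]
   are nonzero.  Hence conjugation, with the means adjusted, is a linear map of square [-1] on the
   space of periodic solutions, and the dimension of that space is even. *)

(** * Primitives of continuous functions and the integral over one period *)

Section Primitive.
Context {R : realType}.
Implicit Types (f g F G : R -> R) (a b t : R).

Definition primitive F f := forall t, is_derive t (1 : R) F (f t).

Lemma primitive_continuous {F f} : primitive F f -> continuous F.
Proof.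
by move=> dF t; apply/differentiable_continuous/derivable1_diffP; case: (dF t).
Qed.

(** The lower limit of integration moves with [x], so that both [x] and 0 lie to its right.
    Subtracting the value at 0 removes the dependence on this limit, which may therefore be frozen
    near a given point. *)
Lemma ex_primitive f : continuous f -> exists F, primitive F f.
Proof.
move=> cf; pose mu := @lebesgue_measure R.
have intf a b : mu.-integrable `[a, b] (EFin \o f).
  apply: continuous_compact_integrable; first exact: segment_compact.
  exact: continuous_subspaceT.
pose P a x : R := \int[mu]_(t in `[a, x]) f t.
have PE a b x : a <= b -> b <= x -> P a x = P a b + \int[mu]_(t in `]b, x]) f t.
  move=> ab bx; rewrite -(Rintegral_itvB (intf a x)) ?bnd_simp//.
  by rewrite addrC subrK.
have Pind a b x : a <= b -> b <= x -> b <= 0 -> P a x - P a 0 = P b x - P b 0.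
  move=> ab bx b0.
  rewrite (PE a b x ab bx) (PE a b 0 ab b0) (PE b b x _ bx)// (PE b b 0 _ b0)//.
  by rewrite [P a b + _]addrC [P b b + _]addrC !addrKA.
exists (fun x => P (- (`|x| + 1)) x - P (- (`|x| + 1)) 0) => t.
have nt := ler_norm t; have nt' := ler_norm (- t); rewrite normrN in nt'.
have n0 := normr_ge0 t.
(* For [s] within distance 1 of [t], the moving lower limit at [s] is still at least [a]. *)
pose a := - (`|t| + 2).
have at_ : a < t by rewrite /a; lra.
have [dP dPE] := @continuous_FTC1_closed R f a t (t + 1) ltac:(lra) (intf _ _) at_ (cf t).
have dPa : is_derive t (1 : R) (P a) (f t).
  by split=> //; rewrite -derive1E.
have dPb : is_derive t (1 : R) (fun x => P a x - P a 0) (f t).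
  by apply: is_derive_eq; rewrite subr0.
apply: (near_eq_is_derive _ dPb).
near=> s.
have st : `|t - s| < 1 by near: s; exact: (nbhsx_ballx t 1 ltr01).
have st' : `|s| <= `|t| + 1.
  by have := lerB_dist s t; rewrite distrC in st; lra.
have ns := ler_norm s; have ns' := ler_norm (- s); rewrite normrN in ns'.
have m0 := normr_ge0 s.
by rewrite /= -(Pind a) //; rewrite /a; lra.
Unshelve. all: by end_near. Qed.

Lemma primitive_ge F f a b m : primitive F f -> a <= b ->
  (forall t, a <= t <= b -> m <= f t) -> m * (b - a) <= F b - F a.
Proof.
move=> dF ab mf.
have cF := continuous_subspaceT (primitive_continuous dF).
have [c] := MVT_segment ab (fun x _ => dF x) (cF _).
rewrite in_itv/= => cab ->; rewrite ler_wpM2r ?subr_ge0//.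
exact: mf.
Qed.

(** The derivative is prescribed only inside the interval because the conjugate functions are shown
    to solve the equations only there. *)
Lemma derive0_eq F a b : a <= b -> continuous F ->
  (forall t, a < t < b -> is_derive t (1 : R) F 0) -> F a = F b.
Proof.
move=> ab cF dF.
have dF' x : x \in `]a, b[ -> is_derive x 1 F ((fun=> 0) x).
  by rewrite in_itv/=; exact: dF.
have [c _] := MVT_segment ab dF' (continuous_subspaceT cF).
by rewrite mul0r => /eqP; rewrite subr_eq0 => /eqP.
Qed.

Definition prim f : R -> R := xget (fun=> 0) [set F | primitive F f].

Lemma primP f : continuous f -> primitive (prim f) f.
Proof.
move=> /ex_primitive[F dF].
exact: (@xgetPex _ (fun=> 0) [set F | primitive F f] (ex_intro _ F dF)).
Qed.

Lemma primB f g F G : primitive F f -> primitive G g ->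
  primitive (fun t => F t - G t) (fun t => f t - g t).
Proof. by move=> dF dG t; have := dF t; have := dG t => ? ?; apply: is_derive_eq. Qed.

Lemma primitive_uniq f F G a b : primitive F f -> primitive G f ->
  F b - F a = G b - G a.
Proof.
move=> dF dG; have := primB _ _ _ _ dF dG => d.
have d' t : is_derive t (1:R) (fun t => F t - G t) 0 by rewrite -(subrr (f t)).
have := is_derive_0_is_cst b a d'; lra.
Qed.

(* The integral of [f] over [[0, 2 pi]]; a junk value if [f] has no primitive. *)
Definition pint f : R := prim f (2 * pi) - prim f 0.

Lemma pint_FTC F f : primitive F f -> pint f = F (2 * pi) - F 0.
Proof.
move=> dF; apply: primitive_uniq (dF).
exact: (@xgetPex _ (fun=> 0) [set F | primitive F f] (ex_intro _ F dF)).
Qed.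

Lemma pint_lin a b f g : continuous f -> continuous g ->
  pint (fun t => a * f t + b * g t) = a * pint f + b * pint g.
Proof.
move=> /primP df /primP dg.
rewrite (pint_FTC (fun t => a * prim f t + b * prim g t)) ?/pint; first by ring.
by move=> t; have := df t; have := dg t => ? ?; apply: is_derive_eq.
Qed.

Lemma pint_bound f m : continuous f -> (forall t, 0 <= t <= 2 * pi -> `|f t| <= m) ->
  `|pint f| <= 2 * pi * m.
Proof.
move=> /primP df fm; have p0 := pi_ge0 R.
have dNf : primitive (fun t => - prim f t) (fun t => - f t).
  by move=> t; have := df t => ?; apply: is_derive_eq.
have fm' t : 0 <= t <= 2 * pi -> - m <= f t /\ - m <= - f t.
  by move=> /fm; rewrite ler_norml lerN2 => /andP[].
have := primitive_ge _ _ 0 (2 * pi) (- m) df ltac:(lra) (fun t ht => proj1 (fm' t ht)).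
have := primitive_ge _ _ 0 (2 * pi) (- m) dNf ltac:(lra) (fun t ht => proj2 (fm' t ht)).
rewrite ler_norml /pint => h1 h2; apply/andP; split; lra.
Qed.

End Primitive.

(** * Fourier coefficients and their recurrences *)

Section Fourier.
Context {R : realType}.
Implicit Types (f g F G : R -> R) (a c t : R) (b : bool) (n k : nat).

(** The boolean treats cosines and sines at once: differentiation and conjugation exchange [b] and
    [~~ b] up to a sign given by [(-1) ^+ b]. *)
Definition trig b n t : R := if b then sin (n%:R * t) else cos (n%:R * t).

(** Unnormalised: in positive frequency, a trigonometric function has coefficient [pi] against
    itself. *)
Definition fcoef b f n : R := pint (fun t => f t * trig b n t).

Lemma is_derive_trig b n t :
  is_derive t (1 : R) (trig b n) (- (-1) ^+ b * n%:R * trig (~~ b) n t).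
Proof.
rewrite /trig; case: b => /=.
  by apply: is_derive_eq; rewrite /GRing.scale/=; ring.
by apply: is_derive_eq; rewrite /GRing.scale/=; ring.
Qed.

Lemma trig_continuous b n : continuous (trig b n).
Proof. exact: primitive_continuous (is_derive_trig b n). Qed.

Lemma trig_le1 b n t : `|trig b n t| <= 1.
Proof.
by rewrite /trig; case: b; rewrite ler_norml ?sin_geN1 ?sin_le1 ?cos_geN1 ?cos_le1.
Qed.

Lemma trig_true0 t : trig true 0 t = 0.
Proof. by rewrite /trig mul0r sin0. Qed.

Lemma trig_false0 t : trig false 0 t = 1.
Proof. by rewrite /trig mul0r cos0. Qed.

Lemma trig_period b n : trig b n (2 * pi) = trig b n 0.
Proof.
rewrite /trig mulr0.
have [-> ->] : sin (n%:R * (2 * pi)) = sin 0 :> R /\ cos (n%:R * (2 * pi)) = cos 0 :> R.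
  elim: n => [|n IH]; first by rewrite !mul0r.
  have -> : n.+1%:R * (2 * pi) = n%:R * (2 * pi) + pi *+ 2 :> R.
    by rewrite -addn1 natrD -(mulr_natl pi); ring.
  by rewrite sinD2pi cosD2pi.
by [].
Qed.

Lemma continuous_mul {f g} : continuous f -> continuous g ->
  continuous (fun t => f t * g t).
Proof. by move=> cf cg t; apply: cvgM; [exact: cf|exact: cg]. Qed.

Lemma continuous_add {f g} : continuous f -> continuous g ->
  continuous (fun t => f t + g t).
Proof. by move=> cf cg t; apply: cvgD; [exact: cf|exact: cg]. Qed.

Lemma continuous_scale {f} a : continuous f -> continuous (fun t => a * f t).
Proof. by move=> cf t; apply: cvgM; [exact: cvg_cst|exact: cf]. Qed.

Lemma fcoef_lin b a c f g n : continuous f -> continuous g ->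
  fcoef b (fun t => a * f t + c * g t) n = a * fcoef b f n + c * fcoef b g n.
Proof.
move=> cf cg; rewrite /fcoef -pint_lin; last 2 first.
- exact: continuous_mul cf (trig_continuous b n).
- exact: continuous_mul cg (trig_continuous b n).
by congr pint; apply/funext => t; ring.
Qed.

Lemma fcoef_scale b a f n : continuous f ->
  fcoef b (fun t => a * f t) n = a * fcoef b f n.
Proof.
move=> cf; have := fcoef_lin b a 0 f f n cf cf; rewrite mul0r addr0 => <-.
by congr (fcoef b _ n); apply/funext => t; ring.
Qed.

Lemma fcoef_true0 f : continuous f -> fcoef true f 0 = 0.
Proof.
move=> cf; rewrite /fcoef (_ : (fun t => _) = fun t => 0 * f t + 0 * f t).
  by rewrite pint_lin// !mul0r addr0.
by apply/funext => t; rewrite trig_true0; ring.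
Qed.

Lemma fcoef_false0 f : fcoef false f 0 = pint f.
Proof. by congr pint; apply/funext => t; rewrite trig_false0 mulr1. Qed.

Lemma fcoef_bound b f n m : continuous f ->
  (forall t, 0 <= t <= 2 * pi -> `|f t| <= m) -> `|fcoef b f n| <= 2 * pi * m.
Proof.
move=> cf fm; apply: pint_bound; first exact: continuous_mul cf (trig_continuous b n).
move=> t /fm {}fm; rewrite normrM (le_trans _ fm)// ler_piMr//.
exact: trig_le1.
Qed.

(** Integration by parts; the boundary term vanishes because [F] and the trigonometric factor agree
    at 0 and [2 * pi]. *)
Lemma fcoef_deriv b F f n : primitive F f -> continuous f -> F (2 * pi) = F 0 ->
  fcoef b f n = (-1) ^+ b * n%:R * fcoef (~~ b) F n.
Proof.
move=> dF cf Fper; have cF := primitive_continuous dF.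
rewrite /fcoef; have cft := continuous_mul cf (trig_continuous b n).
have cFt := continuous_mul cF (trig_continuous (~~ b) n).
have /pint_FTC : primitive (fun t => F t * trig b n t)
    (fun t => 1 * (f t * trig b n t) +
              - ((-1) ^+ b * n%:R) * (F t * trig (~~ b) n t)).
  move=> t; have := dF t => ?; have := is_derive_trig b n t => ?.
  by apply: is_derive_eq; rewrite /GRing.scale/=; ring.
by rewrite pint_lin// Fper trig_period; lra.
Qed.

(** Product-to-sum formula, stated at [n.+1] so that the lower neighbouring frequency is [n]. *)
Lemma trig_cos b n t :
  cos t * trig b n.+1 t = 2^-1 * trig b n.+2 t + 2^-1 * trig b n t.
Proof.
have nE : n.+2%:R * t = n.+1%:R * t + t by rewrite -[n.+2]addn1 natrD; ring.
have nE' : n%:R * t = n.+1%:R * t - t by rewrite -[n.+1]addn1 natrD; ring.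
rewrite /trig nE nE'; case: b; rewrite ?sinD ?cosD ?sinN ?cosN; lra.
Qed.

Lemma trig_sin b n t : sin t * trig b n.+1 t =
  (-1) ^+ b / 2 * trig (~~ b) n.+2 t + - ((-1) ^+ b / 2) * trig (~~ b) n t.
Proof.
have nE : n.+2%:R * t = n.+1%:R * t + t by rewrite -[n.+2]addn1 natrD; ring.
have nE' : n%:R * t = n.+1%:R * t - t by rewrite -[n.+1]addn1 natrD; ring.
rewrite /trig nE nE'; case: b; rewrite /= ?sinD ?cosD ?sinN ?cosN; lra.
Qed.

Lemma fcoef_cos b f n : continuous f ->
  fcoef b (fun t => cos t * f t) n.+1 = 2^-1 * fcoef b f n.+2 + 2^-1 * fcoef b f n.
Proof.
move=> cf; rewrite -pint_lin; last 2 first.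
- exact: continuous_mul cf (trig_continuous _ _).
- exact: continuous_mul cf (trig_continuous _ _).
congr pint; apply/funext => t.
by rewrite [_ * f t]mulrC -mulrA trig_cos; ring.
Qed.

Lemma fcoef_cos0 f : fcoef false (fun t => cos t * f t) 0 = fcoef false f 1.
Proof. by congr pint; apply/funext => t; rewrite /trig mul0r cos0 mul1r; ring. Qed.

Lemma fcoef_sin b f n : continuous f ->
  fcoef b (fun t => sin t * f t) n.+1 =
  (-1) ^+ b / 2 * fcoef (~~ b) f n.+2 + - ((-1) ^+ b / 2) * fcoef (~~ b) f n.
Proof.
move=> cf; rewrite -pint_lin; last 2 first.
- exact: continuous_mul cf (trig_continuous _ _).
- exact: continuous_mul cf (trig_continuous _ _).
congr pint; apply/funext => t.
by rewrite [_ * f t]mulrC -mulrA trig_sin; ring.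
Qed.

Lemma fcoef_sin0 f : fcoef false (fun t => sin t * f t) 0 = fcoef true f 1.
Proof. by congr pint; apply/funext => t; rewrite /trig mul0r cos0 mul1r; ring. Qed.

Definition coefs_zero f := continuous f /\ forall b n, fcoef b f n = 0.

Lemma coefs_zero_cos f : coefs_zero f -> coefs_zero (fun t => cos t * f t).
Proof.
move=> [cf f0]; have cg := continuous_mul (@continuous_cos R) cf; split=> // b.
case=> [|n]; last by rewrite fcoef_cos// !f0; ring.
by case: b; [exact: fcoef_true0|rewrite fcoef_cos0].
Qed.

Lemma coefs_zero_sin f : coefs_zero f -> coefs_zero (fun t => sin t * f t).
Proof.
move=> [cf f0]; have cg := continuous_mul (@continuous_sin R) cf; split=> // b.
case=> [|n]; last by rewrite fcoef_sin// !f0; ring.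
by case: b; [exact: fcoef_true0|rewrite fcoef_sin0].
Qed.

Lemma coefs_zero_lin a c f g : coefs_zero f -> coefs_zero g ->
  coefs_zero (fun t => a * f t + c * g t).
Proof.
move=> [cf f0] [cg g0]; split=> [|b n].
  by apply: continuous_add; exact: continuous_scale.
by rewrite fcoef_lin// f0 g0; ring.
Qed.

(** Vanishing of all coefficients survives multiplication by [cos] and [sin], and [cos (t - s)] is a
    linear combination of these. The powers serve as kernels peaked at [s]. *)
Lemma coefs_zero_kernel f s c k : coefs_zero f ->
  coefs_zero (fun t => (cos (t - s) + c) ^+ k * f t).
Proof.
move=> Pf; elim: k => [|k IH].
  by rewrite (_ : (fun t => _) = f)//; apply/funext => t; rewrite mul1r.
have := coefs_zero_lin 1 c _ _
  (coefs_zero_lin (cos s) (sin s) _ _ (coefs_zero_cos _ IH) (coefs_zero_sin _ IH)) IH.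
congr coefs_zero; apply/funext => t; rewrite cosB exprS; ring.
Qed.

(** Bernoulli's inequality reduces this to the Archimedean property. *)
Lemma exprn_unbounded (q m : R) : 1 < q -> exists k, m < q ^+ k.
Proof.
move=> q1.
have bern k : 1 + k%:R * (q - 1) <= q ^+ k.
  elim: k => [|k IH]; first by rewrite mul0r addr0.
  rewrite exprS -natr1.
  have h1 : q * (1 + k%:R * (q - 1)) <= q * q ^+ k by rewrite ler_wpM2l//; lra.
  have h2 : 0 <= k%:R * (q - 1) ^+ 2 by rewrite mulr_ge0// sqr_ge0.
  by apply: le_trans h1; move: h2; rewrite expr2; lra.
have [k km] : exists k, m / (q - 1) < k%:R.
  exists (Num.truncn (`|m / (q - 1)|)).+1.
  by apply: le_lt_trans (ler_norm _) _; apply: truncnS_gt.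
exists k; apply: lt_le_trans (bern k).
by rewrite ltr_pdivrMr in km; lra.
Qed.

End Fourier.

(** * Uniqueness: vanishing Fourier coefficients force a continuous function to vanish inside the
    period *)

Section Unique.
Context {R : realType}.
Implicit Types (f g F G : R -> R) (a c t : R) (b : bool) (n k : nat).

Lemma cos_lt_0pi (x y : R) : 0 <= x -> x < y -> y <= pi -> cos y < cos x.
Proof. by move=> x0 xy ypi; rewrite ltr_cos// in_itv/=; lra. Qed.

Lemma cos_le_0pi (x y : R) : 0 <= x -> x <= y -> y <= pi -> cos y <= cos x.
Proof.
move=> x0; rewrite le_eqVlt => /predU1P[<- //|xy ypi].
exact/ltW/cos_lt_0pi.
Qed.

(** Beyond [pi], the reflection [2 * pi - s] preserves the cosine and leads back to the interval
    where it decreases. *)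
Lemma cos_le_outside (h s : R) : 0 <= h -> h <= s -> s <= 2 * pi - h ->
  cos s <= cos h.
Proof.
move=> h0 hs sh.
have hpi : h <= pi by lra.
have [spi|spi] := leP s pi.
  exact: cos_le_0pi.
have -> : cos s = cos (2 * pi - s).
  have -> : 2 * pi - s = - s + pi *+ 2 by rewrite -(mulr_natl pi); ring.
  by rewrite cosD2pi cosN.
by apply: cos_le_0pi; lra.
Qed.

Lemma continuous_bounded f a c : continuous f ->
  exists m, forall t, a <= t <= c -> `|f t| <= m.
Proof.
move=> cf; have [ac|ca] := leP a c; last by exists 0 => t /andP[]; lra.
have cn : continuous (fun t => `|f t|) by move=> t; apply: cvg_norm; exact: cf.
have [x _ xm] := EVT_max ac (continuous_subspaceT cn).
by exists `|f x| => t tac; apply: xm; rewrite in_itv.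
Qed.

(* On [|t - s| <= h/2] the kernel [cos (t - s) + 1 - cos h] exceeds a constant [q > 1], and it is
   at most 1 in absolute value for [|t - s| >= h], so the integral of [f] against its [k]-th power
   diverges if [f s > 0]. *)
Lemma coefs_zero_le0 f s : coefs_zero f -> 0 < s < 2 * pi -> f s <= 0.
Proof.
move=> Pf /andP[s0 s2pi]; rewrite leNgt; apply/negP => fs0.
have cf := proj1 Pf.
pose d := f s / 2; have d0 : 0 < d by rewrite /d; lra.
have [r r0 fr] : exists2 r, 0 < r & forall t, `|s - t| < r -> d <= f t.
  have /nbhs_ballP[r /= r0 fr] : \forall t \near s, d <= f t.
    by apply: (cvgr_ge (f s) (cf s)); rewrite /d; lra.
  by exists r => // t; exact: fr.
(* The first bound keeps [f] above [d] within distance [h] of [s]; the other two keep that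
   neighbourhood inside the period. *)
pose h := Num.min (r / 2) (Num.min s (2 * pi - s)).
have h0 : 0 < h by rewrite /h !lt_min; apply/and3P; split; lra.
have [hr hs hs'] : [/\ h <= r / 2, h <= s & h <= 2 * pi - s].
  rewrite /h; split; first by rewrite ge_min lexx.
    by rewrite !ge_min lexx orbT.
  by rewrite !ge_min lexx !orbT.
have hpi : h <= pi by lra.
pose q := cos (h / 2) + (1 - cos h).
have q1 : 1 < q.
  have : cos h < cos (h / 2) by apply: cos_lt_0pi; lra.
  by rewrite /q; lra.
have [m fm] := continuous_bounded f 0 (2 * pi) cf.
have m0 : 0 <= m by apply: le_trans (fm s _); rewrite ?normr_ge0//; lra.
(* With this [k], the central interval, of length [h], contributes at least [q ^+ k * d * h], which
   exceeds [m * (2 * pi)] and so outweighs the loss far from [s]. *)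
have [k km] := exprn_unbounded q (m * (2 * pi) / (d * h)) q1.
pose K t := cos (t - s) + (1 - cos h).
(* The coefficient at frequency 0 is the integral of kernel times [f], so this integral is zero. *)
have [cg /(_ false 0%N)] := coefs_zero_kernel f s (1 - cos h) k Pf.
rewrite fcoef_false0 => Ig0.
have dP := primP _ cg; set P := prim _ in dP.
have Pge0 t : `|t - s| <= h -> 0 <= (K t) ^+ k * f t.
  move=> ts; apply: mulr_ge0; last first.
    by apply: le_trans (ltW d0) (fr _ _); rewrite distrC; lra.
  apply: exprn_ge0.
  have : cos h <= cos (t - s).
    by rewrite -[cos (t - s)]cos_norm; apply: cos_le_0pi => //; lra.
  have := cos_le1 h; rewrite /K; have := cos_geN1 h; lra.
have Pgeq t : `|t - s| <= h / 2 -> q ^+ k * d <= (K t) ^+ k * f t.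
  move=> ts; apply: ler_pM; last by apply: fr; rewrite distrC; lra.
  - by apply: exprn_ge0; lra.
  - exact: ltW.
  - have qK : q <= K t.
      by rewrite /q /K lerD2r -[cos (t - s)]cos_norm; apply: cos_le_0pi => //; lra.
    by apply: lerXn2r; rewrite ?nnegrE//; lra.
have Pge t : 0 <= t <= 2 * pi -> h <= `|t - s| -> - m <= (K t) ^+ k * f t.
  move=> t2pi ts.
  have : `|(K t) ^+ k * f t| <= m.
    rewrite normrM -[m]mul1r ler_pM ?normr_ge0//; last exact: fm.
    rewrite normrX exprn_ile1// ler_norml.
    have : cos (t - s) <= cos h.
      rewrite -[cos (t - s)]cos_norm; apply: cos_le_outside => //; first exact: ltW.
      by rewrite ler_norml; lra.
    have := cos_geN1 (t - s); have := cos_le1 h; rewrite /K; lra.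
  by rewrite ler_norml => /andP[].
have near1 t x : s - x <= t <= s + x -> `|t - s| <= x.
  by rewrite ler_norml; lra.
have far1 t : t <= s - h -> h <= `|t - s|.
  by move=> ?; rewrite ler_normr; apply/orP; right; lra.
have far2 t : s + h <= t -> h <= `|t - s|.
  by move=> ?; rewrite ler_normr; apply/orP; left; lra.
(* The period is cut at distances [h / 2] and [h] on both sides of [s]; the five lower bounds add up
   to a positive integral. *)
have E1 := primitive_ge _ _ 0 (s - h) (- m) dP ltac:(lra)
  (fun t ht => Pge t ltac:(lra) (far1 t ltac:(lra))).
have E2 := primitive_ge _ _ (s - h) (s - h / 2) 0 dP ltac:(lra)
  (fun t ht => Pge0 t (near1 t h ltac:(lra))).
have E3 := primitive_ge _ _ (s - h / 2) (s + h / 2) (q ^+ k * d) dP ltac:(lra)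
  (fun t ht => Pgeq t (near1 t (h / 2) ltac:(lra))).
have E4 := primitive_ge _ _ (s + h / 2) (s + h) 0 dP ltac:(lra)
  (fun t ht => Pge0 t (near1 t h ltac:(lra))).
have E5 := primitive_ge _ _ (s + h) (2 * pi) (- m) dP ltac:(lra)
  (fun t ht => Pge t ltac:(lra) (far2 t ltac:(lra))).
move: km; rewrite ltr_pdivrMr ?mulr_gt0// => km.
have mh : 0 <= m * h by rewrite mulr_ge0// ltW.
by move: Ig0; rewrite (pint_FTC _ _ dP); lra.
Qed.

(** The one-sided bound applies to [f] and to [- f], the latter written as a linear combination. *)
Lemma coefs_zero_eq0 f t : coefs_zero f -> 0 < t < 2 * pi -> f t = 0.
Proof.
move=> Pf ht; apply/eqP; rewrite eq_le coefs_zero_le0//=.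
have := coefs_zero_le0 _ _ (coefs_zero_lin (-1) 0 _ _ Pf Pf) ht; lra.
Qed.

End Unique.

(** * Orthogonality of the trigonometric functions *)

Section Conjugate.
Context {R : realType}.
Implicit Types (f g h F G : R -> R) (a c t : R) (b : bool) (n k N : nat).

Lemma fcoef_deriv2 b F f g n : primitive F f -> primitive f g -> continuous g ->
  F (2 * pi) = F 0 -> f (2 * pi) = f 0 ->
  fcoef b g n = - n%:R ^+ 2 * fcoef b F n.
Proof.
move=> dF df cg Fper fper; have cf := primitive_continuous df.
rewrite (fcoef_deriv b _ _ n df)// (fcoef_deriv (~~ b) _ _ n dF)// negbK.
by case: b => /=; rewrite !(expr0, expr1); ring.
Qed.

Lemma pint_cst c : pint (fun=> c) = 2 * pi * c :> R.
Proof.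
have /pint_FTC -> : primitive (fun t : R => c * t) (fun=> c).
  by move=> t; apply: is_derive_eq; rewrite /GRing.scale/=; ring.
by rewrite mulr0 subr0 mulrC.
Qed.

(** For distinct frequencies, two integrations by parts multiply the integral by two different
    squares, so it vanishes. *)
Lemma fcoef_trig b b' n k :
  fcoef b (trig b' k.+1) n = ((b == b') && (n == k.+1))%:R * pi :> R.
Proof.
have [->|nk] := eqVneq n k.+1; last first.
  rewrite andbF mul0r.
  have d1 := is_derive_trig (R := R) b' k.+1.
  have d2 : primitive (fun t => - (-1) ^+ b' * k.+1%:R * trig (~~ b') k.+1 t : R)
      (fun t => - k.+1%:R ^+ 2 * trig b' k.+1 t).
    move=> t; have := is_derive_trig (R := R) (~~ b') k.+1 t => ?.
    apply: is_derive_eq; rewrite /GRing.scale/= negbK.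
    by case: (b'); rewrite /= !(expr0, expr1); ring.
  have ct : continuous (trig (R := R) b' k.+1) := trig_continuous _ _.
  have := fcoef_deriv2 b _ _ _ n d1 d2 (continuous_scale _ ct).
  rewrite !trig_period => /(_ erefl erefl); rewrite fcoef_scale//.
  move=> /eqP; rewrite -subr_eq0 -mulrBl mulf_eq0 => /orP[|/eqP //].
  rewrite opprK addrC subr_eq0 -!natrX eqr_nat eqn_exp2r//.
  by rewrite (negPf nk).
rewrite andbT; set m := k.+1.
have m0 : m%:R != 0 :> R by rewrite pnatr_eq0.
have half b1 b2 : fcoef b1 (trig b2 m) m = fcoef b2 (trig b1 m) m :> R.
  by congr pint; apply/funext => t; rewrite mulrC.
(* One integration by parts at equal frequency: the squares of cosine and sine have equal integrals,
   and the mixed integral is its own opposite. *)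
have step b1 b2 : - (-1) ^+ b2 * fcoef b1 (trig (~~ b2) m) m =
    (-1) ^+ b1 * fcoef (~~ b1) (trig b2 m) m :> R.
  have ct b3 : continuous (trig (R := R) b3 m) := trig_continuous _ _.
  have := fcoef_deriv b1 _ _ m (is_derive_trig (R := R) b2 m)
    (continuous_scale _ (ct _)) (trig_period _ _).
  rewrite fcoef_scale// => E; apply: (mulfI m0).
  transitivity (- (-1) ^+ b2 * m%:R * fcoef b1 (trig (~~ b2) m) m : R); first by ring.
  by rewrite E; ring.
have sum1 : fcoef false (trig false m) m + fcoef true (trig true m) m = 2 * pi :> R.
  have := pint_cst 1; rewrite mulr1 => <-.
  have := pint_lin 1 1 (fun t : R => trig false m t * trig false m t)
    (fun t : R => trig true m t * trig true m t)
    (continuous_mul (trig_continuous _ _) (trig_continuous _ _))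
    (continuous_mul (trig_continuous _ _) (trig_continuous _ _)).
  rewrite !mul1r => <-; congr pint; apply/funext => t.
  by rewrite !mul1r -!expr2 /trig cos2Dsin2.
have s1 := step false true; have s2 := step false false.
have h1 := half false true.
move: s1 s2; rewrite /= !(expr0, expr1) => s1 s2.
by case: (b); case: (b') => /=; rewrite ?mul1r ?mul0r; lra.
Qed.

(** * A continuous function with prescribed, quadratically decaying Fourier coefficients *)

Section Series.
Variables (A : bool -> nat -> R) (M : R).
Hypothesis AM : forall b n, n.+1%:R ^+ 2 * `|A b n.+1| <= M.

(** The factors 1 here and in [S] give the sums the shape [a * f t + c * g t] of the linearity
    lemmas. *)
Let u k t := 1 * (A false k.+1 * trig false k.+1 t + A true k.+1 * trig true k.+1 t).
Let S := fix S N t : R := if N is N'.+1 then 1 * S N' t + u N' t else 0.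
Let B N : R := 4 * M / N.+1%:R.

Let u_continuous k : continuous (u k).
Proof.
by apply/continuous_scale/continuous_add; apply: continuous_scale; exact: trig_continuous.
Qed.

Let S_continuous N : continuous (S N).
Proof.
elim: N => [|N IH] /=; first by move=> t; exact: cvg_cst.
by apply: continuous_add => //; exact: continuous_scale.
Qed.

Let fcoef_S b n N : fcoef b (S N) n = (0 < n <= N)%:R * (pi * A b n).
Proof.
elim: N => [|N IH] /=.
  have := fcoef_scale b 0 (fun=> 0) n (fun t => cvg_cst (0 : R)).
  by rewrite !mul0r => ->; case: n => [|n]; rewrite ?ltn0 ?andbF mul0r.
have ct b' : continuous (trig (R := R) b' N.+1) := trig_continuous _ _.
have c0 : continuous (fun t => A false N.+1 * trig false N.+1 t + A true N.+1 * trig true N.+1 t).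
  by apply: continuous_add; exact: continuous_scale.
rewrite /u fcoef_lin// IH fcoef_lin// !fcoef_trig.
have [->|nN] := eqVneq n N.+1.
  by rewrite ltnn leqnn; clear IH; case: b; rewrite /=; ring.
have -> : (0 < n <= N.+1)%N = (0 < n <= N)%N by rewrite [(n <= N.+1)%N]leq_eqVlt (negPf nN).
by rewrite !andbF /=; ring.
Qed.

Let M_ge0 : 0 <= M.
Proof. by apply: le_trans (AM true 0); rewrite mulr_ge0// exprn_ge0. Qed.

(** The term is at most [2 * M / x ^+ 2] with [x = k.+1%:R], and [x >= 1] bounds this by the
    telescoping difference [4 * M / (x * (x + 1))]. *)
Let u_le k t : `|u k t| <= B k - B k.+1.
Proof.
rewrite /u /B mul1r -[k.+2]addn1 natrD; have := AM false k; have := AM true k.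
have x1 : 1 <= (k.+1%:R : R) by rewrite ler1n.
move: (k.+1%:R) x1 => x x1 A1 A2.
have At b : `|A b k.+1 * trig b k.+1 t| <= `|A b k.+1|.
  by rewrite normrM ler_piMr// trig_le1.
have -> : 4 * M / x - 4 * M / (x + 1) = 4 * M / (x * (x + 1)).
  by field; apply/andP; split; lra.
apply: le_trans (ler_normD _ _) _; apply: le_trans (lerD (At _) (At _)) _.
have p0 b := normr_ge0 (A b k.+1).
rewrite ler_pdivlMr; last by rewrite mulr_gt0; lra.
have h b : 0 <= `|A b k.+1| * (x * (x - 1)) by rewrite !mulr_ge0//; lra.
have := h true; have := h false; rewrite expr2 in A1 A2; lra.
Qed.

Let S_dist N m t : (N <= m)%N -> `|S m t - S N t| <= B N - B m.
Proof.
move=> /subnK <-; elim: (m - N)%N => [|j IH]; first by rewrite add0n !subrr normr0.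
rewrite addSn /= mul1r; have := u_le (j + N) t.
have := ler_normD (S (j + N) t - S N t) (u (j + N) t).
rewrite addrAC; lra.
Qed.

Let B_ge0 N : 0 <= B N.
Proof. by rewrite /B divr_ge0// mulr_ge0. Qed.

(** The intervals of radius [B N] around [S N t] meet pairwise, so the supremum of their left ends
    lies in all of them: this is the uniform limit of the partial sums. *)
Let h t := sup [set S N t - B N | N in setT].

Let S_mono N m t : S N t - B N <= S m t + B m.
Proof.
have := B_ge0 N; have := B_ge0 m.
have [/(S_dist _ _ t)|/ltnW/(S_dist _ _ t)] := leqP N m.
  by rewrite ler_norml => /andP[]; lra.
by rewrite ler_norml => /andP[]; lra.
Qed.

Let h_dist N t : `|h t - S N t| <= B N.
Proof.
have ubS m : ubound [set S N t - B N | N in setT] (S m t + B m).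
  by move=> _ [k _ <-]; exact: S_mono.
have h1 : S N t - B N <= h t.
  by apply: ub_le_sup; [exists (S 0 t + B 0); exact: ubS|exists N].
have h2 : h t <= S N t + B N.
  by apply: ge_sup; [exists (S 0 t - B 0), 0%N|exact: ubS].
by rewrite ler_norml; lra.
Qed.

Let B_small (e : R) : 0 < e -> exists n0, forall N, (n0 <= N)%N -> B N < e.
Proof.
move=> e0; exists (Num.truncn (4 * M / e)).+1 => // N nN.
rewrite /B ltr_pdivrMr// [e * _]mulrC -ltr_pdivrMr//.
apply: lt_le_trans (truncnS_gt _) _; rewrite ler_nat.
exact: leqW.
Qed.

Let h_continuous : continuous h.
Proof.
move=> t; apply/cvgrPdist_lt => e e0.
have [N /(_ N (leqnn _)) BN] : exists n0, forall N, (n0 <= N)%N -> B N < e / 3.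
  by apply: B_small; rewrite divr_gt0.
have e3 : 0 < e / 3 by rewrite divr_gt0.
have /cvgrPdist_lt/(_ _ e3) := S_continuous N t; apply: filterS => s.
have := h_dist N t; have := h_dist N s; rewrite !ler_norml !ltr_norml; lra.
Qed.

Lemma ex_fourier_series : exists2 h, continuous h &
  pint h = 0 /\ forall b n, fcoef b h n.+1 = pi * A b n.+1.
Proof.
(* From [N >= n] on, the coefficient of [S N] no longer changes, and it differs from that of [h] by
   at most [2 * pi] times the uniform distance. *)
have lim b n N : (n <= N)%N ->
    `|fcoef b h n - (0 < n)%:R * (pi * A b n)| <= 2 * pi * B N.
  move=> nN; have := fcoef_S b n N; rewrite nN andbT => <-.
  have := fcoef_lin b 1 (-1) h (S N) n h_continuous (S_continuous N).
  rewrite mul1r mulN1r => <-; apply: fcoef_bound.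
    by apply: continuous_add; exact: continuous_scale.
  by move=> t _; rewrite mul1r mulN1r.
have {}lim b n : fcoef b h n = (0 < n)%:R * (pi * A b n).
  apply/eqP; rewrite -subr_eq0 -normr_le0 leNgt; apply/negP => d0.
  set d := `|_| in d0.
  have p0 := pi_gt0 R.
  have p2 : 0 < 2 * pi :> R by lra.
  have [N0 BN0] := B_small (d / (2 * pi)) (divr_gt0 d0 p2).
  have := lim b n (maxn n N0) (leq_maxl _ _); rewrite -/d.
  have := BN0 _ (leq_maxr n N0); rewrite ltr_pdivlMr; lra.
exists h => //; split; first by rewrite -fcoef_false0 lim mul0r.
by move=> b n; rewrite lim mul1r.
Qed.

End Series.

(** * Existence of the harmonic conjugate *)

(** Periodicity is expressed by equal values at 0 and [2 * pi] of the function and its first [k]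
    derivatives, which is what integration by parts over one period uses. *)
Fixpoint periodicC k f : Prop :=
  match k with
  | 0 => continuous f /\ f (2 * pi) = f 0
  | k'.+1 => f (2 * pi) = f 0 /\ exists2 f', primitive f f' & periodicC k' f'
  end.

(* The conjugate series is only summed for the second derivative, where it converges uniformly,
   and then integrated twice. *)
Lemma ex_conjugate F c : periodicC 4 F -> exists g g1 g2,
  [/\ primitive g g1, primitive g1 g2, continuous g2,
      g (2 * pi) = g 0 /\ g1 (2 * pi) = g1 0 &
      pint g = c /\ forall b n, fcoef b g n.+1 = - (-1) ^+ b * fcoef (~~ b) F n.+1].
Proof.
move=> [p0 [F1 d1 [p1 [F2 d2 [p2 [F3 d3 [p3 [F4 d4 [c4 p4]]]]]]]]].
have pi0 := pi_gt0 R.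
have c3 := primitive_continuous d4.
have c2 := primitive_continuous d3.
have [m Fm] := continuous_bounded F4 0 (2 * pi) c4.
(* Conjugated coefficients of the second derivative, divided by [pi] for the normalisation. The
   bound on the fourth derivative yields their quadratic decay. *)
pose A b n := - (-1) ^+ b * fcoef (~~ b) F2 n / pi.
have A0 b n : n.+1%:R ^+ 2 * `|A b n.+1| <= 2 * m.
  have := fcoef_bound (~~ b) F4 n.+1 m c4 Fm.
  rewrite (fcoef_deriv2 _ _ _ _ _ d3 d4)// normrM normrN normrX normr_nat.
  rewrite /A !normrM normrN normfV (gtr0_norm pi0) normrX normrN1 expr1n mul1r.
  by rewrite mulrA ler_pdivrMr// [2 * pi]mulrC; lra.
have [h ch [h0 hA]] := ex_fourier_series A (2 * m) A0.
pose q := prim h; have dq : primitive q h := primP _ ch.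
(* Subtracting the mean gives [g1] integral zero, which makes its primitive take equal values at
   both ends. *)
pose g1 t := q t - pint q / (2 * pi).
have cq := primitive_continuous dq.
have dg1 : primitive g1 h.
  by move=> t; have := dq t => ?; apply: is_derive_eq; rewrite subr0.
have cg1 := primitive_continuous dg1.
have Ig1 : pint g1 = 0.
  have := pint_lin 1 (- (pint q / (2 * pi))) q (fun=> 1) cq (fun t => cvg_cst (1 : R)).
  rewrite pint_cst (_ : (fun t => _) = g1); last by apply/funext => t; rewrite /g1; ring.
  by move=> ->; field; lra.
pose r := prim g1; have dr : primitive r g1 := primP _ cg1.
have cr := primitive_continuous dr.
(* The additive constant is the one that makes the integral of [g] equal to [c]. *)
pose g t := r t + (c - pint r) / (2 * pi).
have dg : primitive g g1.
  by move=> t; have := dr t => ?; apply: is_derive_eq; rewrite addr0.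
have g1per : g1 (2 * pi) = g1 0.
  by apply/eqP; rewrite -subr_eq0 -(pint_FTC _ _ dg1) h0.
have gper : g (2 * pi) = g 0.
  by apply/eqP; rewrite -subr_eq0 -(pint_FTC _ _ dg) Ig1.
exists g, g1, h; split=> //; split.
  have := pint_lin 1 ((c - pint r) / (2 * pi)) r (fun=> 1) cr (fun t => cvg_cst (1 : R)).
  rewrite pint_cst (_ : (fun t => _) = g); last by apply/funext => t; rewrite /g; ring.
  by move=> ->; field; lra.
move=> b n; have := hA b n.
rewrite (fcoef_deriv2 _ _ _ _ _ dg dg1)// /A (fcoef_deriv2 _ _ _ _ _ d1 d2)//.
have n0 : - n.+1%:R ^+ 2 != 0 :> R by rewrite oppr_eq0 expf_neq0// pnatr_eq0.
move=> E; apply: (mulfI n0); rewrite E; field; lra.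
Qed.

End Conjugate.

(** * Conjugation applied to the differential equations *)

Section Conj.
Context {R : realType}.
Implicit Types (f g h F G x y u z : R -> R) (c e t : R) (b : bool) (n k : nat).

Lemma periodicC_pred k f : periodicC k.+1 f -> periodicC k f.
Proof.
elim: k f => [|k IH] f [f0 [f' df f'k]].
  by split=> //; exact: primitive_continuous df.
by split=> //; exists f' => //; exact: IH.
Qed.

Lemma periodicC_lin k f g c e : periodicC k f -> periodicC k g ->
  periodicC k (fun t => c * f t + e * g t).
Proof.
elim: k f g => [|k IH] f g /=.
  move=> [cf f0] [cg g0]; split; last by rewrite f0 g0.
  by apply: continuous_add; exact: continuous_scale.
move=> [f0 [f' df f'k]] [g0 [g' dg g'k]]; split; first by rewrite f0 g0.
exists (fun t => c * f' t + e * g' t); last exact: IH.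
by move=> t; have := df t; have := dg t => ? ?; apply: is_derive_eq.
Qed.

Lemma periodicC_mul k f g : periodicC k f -> periodicC k g ->
  periodicC k (fun t => f t * g t).
Proof.
elim: k f g => [|k IH] f g.
  by move=> [cf f0] [cg g0]; split; [exact: continuous_mul|rewrite f0 g0].
move=> fk gk; have fk' := periodicC_pred _ _ fk; have gk' := periodicC_pred _ _ gk.
case: fk gk => [f0 [f' df f'k]] [g0 [g' dg g'k]]; split; first by rewrite f0 g0.
exists (fun t => 1 * (f' t * g t) + 1 * (f t * g' t)).
  move=> t; have := df t; have := dg t => ? ?; apply: is_derive_eq.
  by rewrite /GRing.scale/=; ring.
by apply: periodicC_lin; exact: IH.
Qed.

Lemma periodicC_cst k c : periodicC k (fun=> c).
Proof.
elim: k c => [|k IH] c; first by split=> // t; exact: cvg_cst.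
by split=> //; exists (fun=> 0) => // t; exact: is_derive_cst.
Qed.

Lemma periodicC_trig k b n : periodicC k (trig (R := R) b n).
Proof.
elim: k b => [|k IH] b; first by split; [exact: trig_continuous|exact: trig_period].
split; first exact: trig_period.
exists (fun t => - (-1) ^+ b * n%:R * trig (~~ b) n t); first exact: is_derive_trig.
by apply: periodicC_mul (IH _); exact: periodicC_cst.
Qed.

Lemma trig1 b : trig b 1 = if b then sin else cos :> (R -> R).
Proof. by apply/funext => t; rewrite /trig mul1r; case: b. Qed.

Lemma periodicC_cos k : periodicC k (@cos R).
Proof. by rewrite -(trig1 false); exact: periodicC_trig. Qed.

Lemma periodicC_sin k : periodicC k (@sin R).
Proof. by rewrite -(trig1 true); exact: periodicC_trig. Qed.

Lemma ellipse_gt0 e t : 0 <= e -> e < 1 -> 0 < 1 + e * cos t.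
Proof.
move=> e0 e1; have := cos_geN1 t; have := cos_le1 t => h1 h2.
have : 0 <= e * (cos t + 1) by rewrite mulr_ge0//; lra.
by lra.
Qed.

(** The derivative is [e * sin t] times the square of the function itself, which drives the
    induction on [k]. *)
Lemma periodicC_ellipse_inv e k : 0 <= e -> e < 1 ->
  periodicC k (fun t => (1 + e * cos t)^-1).
Proof.
move=> e0 e1; have r0 t : 1 + e * cos t != 0 by rewrite gt_eqF// ellipse_gt0.
have rper : (1 + e * cos (2 * pi))^-1 = (1 + e * cos 0)^-1.
  by have [_ ->] := periodicC_cos 0.
have dr : primitive (fun t => (1 + e * cos t)^-1)
    (fun t => e * (sin t * ((1 + e * cos t)^-1 * (1 + e * cos t)^-1))).
  move=> t; have d1 : is_derive t (1 : R) (fun t => 1 + e * cos t) (- (e * sin t)).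
    by apply: is_derive_eq; rewrite /GRing.scale/=; ring.
  have d2 := @is_deriveV R (fun t => 1 + e * cos t) t _ 1 (r0 t) d1.
  by apply: is_derive_eq; rewrite /GRing.scale/= ?expr2; field.
elim: k => [|k IH]; first by split=> //; exact: primitive_continuous dr.
split=> //; eexists; first exact: dr.
apply: periodicC_mul (periodicC_cst _ _) _.
by apply: periodicC_mul (periodicC_sin _) (periodicC_mul _ _ _ IH IH).
Qed.

(** Frequency 0 is left free, so additive constants can still be adjusted. *)
Definition conjugate f g :=
  forall b n, fcoef b g n.+1 = - (-1) ^+ b * fcoef (~~ b) f n.+1.

Lemma conjugate_lin c e f f' g g' :
  continuous f -> continuous f' -> continuous g -> continuous g' ->
  conjugate f g -> conjugate f' g' ->
  conjugate (fun t => c * f t + e * f' t) (fun t => c * g t + e * g' t).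
Proof. by move=> cf cf' cg cg' fg fg' b n; rewrite !fcoef_lin// fg fg'; ring. Qed.

Lemma conjugate_sym f g : continuous f ->
  conjugate f g -> conjugate g (fun t => (-1) * f t).
Proof.
move=> cf fg b n; rewrite fcoef_scale// fg negbK.
by case: b; rewrite /= !(expr0, expr1); ring.
Qed.

Section Second_order.
Context {c : R} {F F1 F2 G G1 G2 : R -> R}.
Hypotheses (dF : primitive F F1) (dF1 : primitive F1 F2) (cF2 : continuous F2).
Hypotheses (dG : primitive G G1) (dG1 : primitive G1 G2).
Hypotheses (F0 : F (2 * pi) = F 0) (F10 : F1 (2 * pi) = F1 0) (G0 : G (2 * pi) = G 0).

(** Common shape of [x'' - 2 y'] and [y'' + 2 x'], for [c = -2] and [c = 2]. *)
Let u t := 1 * F2 t + c * G1 t.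

Lemma second_order_continuous : continuous u.
Proof.
by apply: continuous_add; apply: continuous_scale => //; exact: primitive_continuous dG1.
Qed.

Lemma fcoef_second_order b n :
  fcoef b u n = - n%:R ^+ 2 * fcoef b F n + c * (-1) ^+ b * n%:R * fcoef (~~ b) G n.
Proof.
have cG1 := primitive_continuous dG1.
by rewrite fcoef_lin// (fcoef_deriv2 _ _ _ _ _ dF dF1)// (fcoef_deriv _ _ _ _ dG)//; ring.
Qed.

Lemma fcoef_second_order0 b : fcoef b u 0 = 0.
Proof. by rewrite fcoef_second_order; ring. Qed.

End Second_order.

Lemma conjugate_second_order {c F F1 F2 G G1 G2 X X1 X2 Y Y1 Y2} :
  primitive F F1 -> primitive F1 F2 -> continuous F2 ->
  primitive G G1 -> primitive G1 G2 ->
  F (2 * pi) = F 0 -> F1 (2 * pi) = F1 0 -> G (2 * pi) = G 0 ->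
  primitive X X1 -> primitive X1 X2 -> continuous X2 ->
  primitive Y Y1 -> primitive Y1 Y2 ->
  X (2 * pi) = X 0 -> X1 (2 * pi) = X1 0 -> Y (2 * pi) = Y 0 ->
  conjugate F X -> conjugate G Y ->
  conjugate (fun t => 1 * F2 t + c * G1 t) (fun t => 1 * X2 t + c * Y1 t).
Proof.
move=> dF dF1 cF2 dG dG1 F0 F10 G0 dX dX1 cX2 dY dY1 X0 X10 Y0 FX GY b n.
rewrite (fcoef_second_order dX dX1 cX2 dY dY1)//.
rewrite (fcoef_second_order dF dF1 cF2 dG dG1)// FX GY negbK.
by case: b; rewrite /= !(expr0, expr1); ring.
Qed.

Section Residual.
Variables (e c : R) (u z : R -> R).
Hypotheses (cu : continuous u) (cz : continuous z) (u0 : forall b, fcoef b u 0 = 0).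

(** The defect of the equation [(1 + e * cos t) * u t = c * z t]. *)
Let G t := 1 * (1 * u t + e * (cos t * u t)) + - c * z t.

Lemma residual_continuous : continuous G.
Proof.
apply: continuous_add; apply: continuous_scale => //.
apply: continuous_add; apply: continuous_scale => //.
exact: continuous_mul (@continuous_cos R) cu.
Qed.

Lemma fcoef_residual b n : fcoef b G n.+1 =
  fcoef b u n.+1 + e / 2 * (fcoef b u n.+2 + fcoef b u n) - c * fcoef b z n.+1.
Proof.
have c1 := continuous_mul (@continuous_cos R) cu.
have c2 : continuous (fun t => 1 * u t + e * (cos t * u t)).
  by apply: continuous_add; exact: continuous_scale.
by rewrite fcoef_lin// fcoef_lin// fcoef_cos//; ring.
Qed.

Lemma fcoef_residual0 : fcoef false G 0 = e * fcoef false u 1 - c * pint z.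
Proof.
have c1 := continuous_mul (@continuous_cos R) cu.
have c2 : continuous (fun t => 1 * u t + e * (cos t * u t)).
  by apply: continuous_add; exact: continuous_scale.
by rewrite fcoef_lin// fcoef_lin// fcoef_cos0 u0 -fcoef_false0; ring.
Qed.

End Residual.

Lemma fcoef0 b n : fcoef b (fun=> 0) n = 0 :> R.
Proof.
have := fcoef_scale b 0 (fun=> 0) n (fun t => cvg_cst (0 : R)).
by rewrite !mul0r => ->.
Qed.

(** All coefficients of the defect for [u'] and [z'] vanish: in positive frequency they are, up to
    sign, those of the original defect, and at frequency 0 the prescribed integral of [z'] cancels
    the term in [e]. *)
Lemma conjugate_residual e c u z u' z' :
  continuous u -> continuous z -> continuous u' -> continuous z' ->
  (forall b, fcoef b u 0 = 0) -> (forall b, fcoef b u' 0 = 0) ->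
  conjugate u u' -> conjugate z z' ->
  (forall t, (1 + e * cos t) * u t = c * z t) ->
  c * pint z' = - e * fcoef true u 1 ->
  forall t, 0 < t < 2 * pi -> (1 + e * cos t) * u' t = c * z' t.
Proof.
move=> cu cz cu' cz' u0 u'0 uu' zz' uz Iz' t ht.
suff /coefs_zero_eq0/(_ ht) : coefs_zero
    (fun t => 1 * (1 * u' t + e * (cos t * u' t)) + - c * z' t) by lra.
split=> [|b [|n]]; first exact: residual_continuous.
  case: b; first by apply: fcoef_true0; exact: residual_continuous.
  by rewrite fcoef_residual0// uu' Iz' /= expr0; ring.
have := fcoef_residual e c u z cu cz (~~ b) n.
rewrite (_ : (fun t => _) = fun=> 0); last first.
  by apply/funext => s; have := uz s; lra.
rewrite fcoef0 => E.
(* The lower neighbour may be frequency 0, where [conjugate] says nothing but both coefficients are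
   zero. *)
have uu'n : fcoef b u' n = - (-1) ^+ b * fcoef (~~ b) u n.
  by case: n {E} => [|n]; rewrite ?u0 ?u'0 ?mulr0// uu'.
by rewrite fcoef_residual// !uu' uu'n zz'; move: E; case: (b); rewrite /= !(expr0, expr1); lra.
Qed.

(** Only the mean of [z] remains, and the frequency-0 equation reads [c * pint z = 0]. *)
Lemma residual_zero e c u z : c != 0 -> continuous u -> continuous z ->
  (forall b, fcoef b u 0 = 0) ->
  (forall t, (1 + e * cos t) * u t = c * z t) ->
  (forall b n, fcoef b u n.+1 = 0) -> (forall b n, fcoef b z n.+1 = 0) ->
  forall t, 0 < t < 2 * pi -> z t = 0.
Proof.
move=> c0 cu cz u0 uz un zn t; apply: coefs_zero_eq0; split=> // b [|n] //.
case: b; first exact: fcoef_true0.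
have := fcoef_residual0 e c u z cu cz u0; rewrite -fcoef_false0 un.
rewrite (_ : (fun t => _) = fun=> 0); last first.
  by apply/funext => s; have := uz s; lra.
by rewrite fcoef0 mulr0 sub0r => /esym/eqP; rewrite oppr_eq0 mulf_eq0 (negPf c0) => /eqP.
Qed.

End Conj.

(** * Linear algebra: complex structures and even dimension *)

(* [r] is the graph of a linear map squaring to [-1], and [det (k ^ 2) = (-1) ^ n] is a square
   only for even [n]. *)
Lemma even_rank (F : realFieldType) m n (A : 'M[F]_(m, n)) (r : 'rV[F]_n -> 'rV[F]_n -> Prop) :
  (forall u, (u <= A)%MS -> exists2 w, (w <= A)%MS & r u w) ->
  (forall c u w u' w', (u <= A)%MS -> (w <= A)%MS -> (u' <= A)%MS -> (w' <= A)%MS ->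
    r u w -> r u' w' -> r (c *: u + u') (c *: w + w')) ->
  (forall u w, (u <= A)%MS -> (w <= A)%MS -> r u w -> r w (- u)) ->
  (forall w, (w <= A)%MS -> r 0 w -> w = 0) ->
  ~~ odd (\rank A).
Proof.
move=> rex rlin rsym runiq.
pose B := row_base A.
have BA i : (row i B <= A)%MS by rewrite (submx_trans (row_sub _ _))// eq_row_base.
have [f fP] : exists f : 'I_(\rank A) -> 'rV[F]_n, forall i, (f i <= A)%MS /\ r (row i B) (f i).
  apply: (@fin_all_exists _ (fun=> _) (fun i w => (w <= A)%MS /\ r (row i B) w)) => i.
  by have [w ? ?] := rex _ (BA i); exists w.
pose W := \matrix_i f i.
have WA : (W <= A)%MS by apply/row_subP => i; rewrite rowK; case: (fP i).
(* [k] is the matrix of the map in the basis [B]. *)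
have [k Wk] : exists k, W = k *m B.
  by apply/submxP; rewrite eq_row_base.
have r0 : r 0 0.
  have [w wA] := rex 0 (sub0mx _ _).
  move=> r0w; have := rlin (-1) _ _ _ _ (sub0mx _ _) wA (sub0mx _ _) wA r0w r0w.
  by rewrite scaler0 addr0 scaleN1r addNr.
have rcomb (c : 'rV[F]_(\rank A)) :
    [/\ (c *m B <= A)%MS, (c *m W <= A)%MS & r (c *m B) (c *m W)].
  rewrite !mulmx_sum_row.
  elim/big_ind2: _ => [|u w u' w' [uA wA uw] [u'A w'A uw']|i _].
  - by rewrite sub0mx.
  - by rewrite !addmx_sub//; split=> //; rewrite -[u]scale1r -[w]scale1r; exact: rlin.
  - have [fA Bf] := fP i; rewrite rowK !scalemx_sub//; split=> //.
    have := rlin (c 0 i) _ _ _ _ (BA i) fA (sub0mx _ _) (sub0mx _ _) Bf r0.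
    by rewrite !addr0.
(* Each [f i] is related both to minus the basis row and to its image under [k]; the difference of
   the two is related to 0, hence zero. *)
have kB0 : k *m k *m B + B = 0.
  apply/row_matrixP => i; rewrite row0.
  have [kA kWA r1] := rcomb (row i k).
  have [fA Bf] := fP i; have r2 := rsym _ _ (BA i) fA Bf.
  have nBA : (- row i B <= A)%MS by rewrite eqmx_opp.
  have E1 : row i k *m B = f i by rewrite -row_mul -Wk rowK.
  have E2 : row i k *m W = row i (k *m k *m B) by rewrite Wk !row_mul mulmxA.
  rewrite E1 E2 in r1; rewrite E2 in kWA.
  apply: runiq; first by rewrite linearD /= addmx_sub.
  have := rlin (-1) _ _ _ _ fA nBA fA kWA r2 r1.
  by rewrite !scaleN1r opprK addNr linearD /= addrC.
have kk : k *m k = - 1%:M.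
  apply: (row_free_inj (row_base_free A)).
  by apply/eqP; rewrite mulNmx mul1mx -addr_eq0 kB0.
have := congr1 determinant kk; rewrite det_mulmx -scaleN1r scalemx1 det_scalar.
rewrite -signr_odd; case: (odd _) => //=; rewrite expr1 => kE.
by have := sqr_ge0 (\det k); rewrite expr2 kE; lra.
Qed.

(** * The Hamiltonian flow, its symplectic form and uniqueness of solutions *)

Section Flow.
Context {R : realType}.
Variables (alpha beta e : R) (xi : R -> 'M[R]_4).
Hypotheses (e0 : 0 <= e) (e1 : e < 1).
Hypothesis xiP : fundamental_solution alpha beta e xi.
Implicit Types (v w : 'cV[R]_4) (t T : R) (i : 'I_4).

Let p := 1 + alpha + 3 * beta.
Let q := 1 + alpha - 3 * beta.
Let r t := (1 + e * cos t)^-1.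

Let o0 : 'I_4 := Ordinal (isT : 0 < 4)%N.
Let o1 : 'I_4 := Ordinal (isT : 1 < 4)%N.
Let o2 : 'I_4 := Ordinal (isT : 2 < 4)%N.
Let o3 : 'I_4 := Ordinal (isT : 3 < 4)%N.

Let sum4 (F : 'I_4 -> R) : \sum_i F i = F o0 + F o1 + F o2 + F o3.
Proof.
rewrite !big_ord_recl big_ord0 addr0 !addrA.
by congr (F _ + F _ + F _ + F _); apply/val_inj.
Qed.

Let ord4 (P : 'I_4 -> Prop) : P o0 -> P o1 -> P o2 -> P o3 -> forall i, P i.
Proof.
move=> P0 P1 P2 P3 [[|[|[|[|//]]]] lti].
- by rewrite (_ : Ordinal lti = o0)//; exact/val_inj.
- by rewrite (_ : Ordinal lti = o1)//; exact/val_inj.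
- by rewrite (_ : Ordinal lti = o2)//; exact/val_inj.
- by rewrite (_ : Ordinal lti = o3)//; exact/val_inj.
Qed.

Let field t v : 'cV[R]_4 := Jmx R *m Bmx alpha beta e t *m v.

(** With [x], [y] the last two components, the first two are the momenta [x' - y] and [y' + x]. *)
Let fieldE t v :
  [/\ field t v o0 0 = v o1 0 - (1 - p * r t) * v o2 0,
      field t v o1 0 = - v o0 0 - (1 - q * r t) * v o3 0,
      field t v o2 0 = v o0 0 + v o3 0 &
      field t v o3 0 = v o1 0 - v o2 0].
Proof.
by split; rewrite /field -mulmxA mxE sum4 !mxE /= !sum4 !mxE /=; rewrite /p /q /r; ring.
Qed.

Definition flow i v t : R := (xi t *m v) i 0.

Lemma flow_primitive i v : primitive (flow i v) (fun t => field t (xi t *m v) i 0).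
Proof.
move=> t; have [_ dxi] := xiP.
have -> : flow i v = \sum_j (fun s => xi s i j * v j 0).
  by apply/funext => s; rewrite /flow mxE fct_sumE.
have -> : field t (xi t *m v) i 0 =
    \sum_j (Jmx R *m Bmx alpha beta e t *m xi t) i j * v j 0.
  by rewrite /field mulmxA mxE.
apply: is_derive_sum => j; have := dxi t i j => ?.
by apply: is_derive_eq; rewrite /GRing.scale/=; ring.
Qed.

(** The symplectic form [v^T J w]. *)
Let Om v w : R := - (v o0 0 * w o2 0) - v o1 0 * w o3 0 + v o2 0 * w o0 0 + v o3 0 * w o1 0.

(** The coefficient matrix [Bmx] is symmetric, so the symplectic form of two solutions has
    derivative zero. *)
Let Om_const (Z : R -> 'cV[R]_4) T v : 0 <= T ->
  (forall i, continuous (fun t => Z t i 0)) ->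
  (forall t i, 0 < t < T -> is_derive t (1 : R) (fun s => Z s i 0) (field t (Z t) i 0)) ->
  Om (xi T *m v) (Z T) = Om v (Z 0).
Proof.
move=> T0 cZ dZ; have -> : Om v (Z 0) = Om (xi 0 *m v) (Z 0) by rewrite (proj1 xiP) mul1mx.
have cf i := primitive_continuous (flow_primitive i v).
apply/esym; apply: (@derive0_eq R (fun t => Om (xi t *m v) (Z t)) 0 T T0) => [|t tT].
  have cm i j := continuous_mul (cf i) (cZ j).
  rewrite /Om; apply: continuous_add (cm o3 o1); apply: continuous_add (cm o2 o0).
  move=> t; apply: cvgB; last exact: cm.
  by apply: cvgN; exact: cm.
have d i := flow_primitive i v t; have dz i := dZ t i tT; rewrite /flow in d.
rewrite /Om.
have := d o0; have := d o1; have := d o2; have := d o3.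
have := dz o0; have := dz o1; have := dz o2; have := dz o3.
have [-> -> -> ->] := fieldE t (Z t); have [-> -> -> ->] := fieldE t (xi t *m v).
move=> ? ? ? ? ? ? ? ?; apply: is_derive_eq; rewrite /GRing.scale/=; ring.
Qed.

Let Om_nondeg w : (forall v, Om v w = 0) -> w = 0.
Proof.
move=> w0; apply/colP; apply: ord4.
- by have := w0 (delta_mx o2 0); rewrite /Om !mxE /=; lra.
- by have := w0 (delta_mx o3 0); rewrite /Om !mxE /=; lra.
- by have := w0 (delta_mx o0 0); rewrite /Om !mxE /=; lra.
- by have := w0 (delta_mx o1 0); rewrite /Om !mxE /=; lra.
Qed.

Lemma fundamental_solution_inj T w : 0 <= T -> xi T *m w = 0 -> w = 0.
Proof.
move=> T0 xw0; apply: Om_nondeg => v.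
have := Om_const (fun t => xi t *m w) T v T0
  (fun k => primitive_continuous (flow_primitive k _))
  (fun t k _ => flow_primitive k _ t).
rewrite /= (proj1 xiP) mul1mx xw0 => <-.
by rewrite /Om !mxE; ring.
Qed.

(** Both sides have the same symplectic product with every [u]: pulling [u] back by the inverse of
    [xi T] reduces each product to the same one at time 0. Nondegeneracy concludes. *)
Lemma solution_unique (Z : R -> 'cV[R]_4) T : 0 <= T ->
  (forall i, continuous (fun t => Z t i 0)) ->
  (forall t i, 0 < t < T ->
    is_derive t (1 : R) (fun s => Z s i 0) ((Jmx R *m Bmx alpha beta e t *m Z t) i 0)) ->
  Z T = xi T *m Z 0.
Proof.
move=> T0 cZ dZ; apply/eqP; rewrite -subr_eq0; apply/eqP; apply: Om_nondeg => u.
have Munit : xi T \in unitmx.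
  rewrite -unitmx_tr -row_free_unit; apply: inj_row_free => v vM.
  apply: trmx_inj; rewrite trmx0; apply: fundamental_solution_inj T0 _.
  by rewrite -[xi T]trmxK -trmx_mul vM trmx0.
have E1 := Om_const Z T (invmx (xi T) *m u) T0 cZ dZ.
have E2 := Om_const (fun t => xi t *m Z 0) T (invmx (xi T) *m u) T0
  (fun k => primitive_continuous (flow_primitive k _))
  (fun t k _ => flow_primitive k _ t).
rewrite /= mulKVmx// (proj1 xiP) mul1mx in E1 E2.
by move: (xi T *m Z 0) E1 E2 => z; rewrite /Om !mxE; lra.
Qed.

(** * Regularity and second-order form of periodic solutions *)

Section Periodic.
Variable v : 'cV[R]_4.
Hypothesis vper : xi (2 * pi) *m v = v.

(** Bootstrap: the derivatives are combinations of the components with smooth periodic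
    coefficients. *)
Lemma flow_periodicC k i : periodicC k (flow i v).
Proof.
elim: k i => [|k IH] i.
  split; first exact: primitive_continuous (flow_primitive i v).
  by rewrite /flow vper (proj1 xiP) mul1mx.
split; first by rewrite /flow vper (proj1 xiP) mul1mx.
eexists; first exact: flow_primitive.
have rk := periodicC_ellipse_inv e k e0 e1.
have ck c j : periodicC k (fun t => (c * r t) * flow j v t).
  by apply: periodicC_mul (IH j); apply: periodicC_mul rk; exact: periodicC_cst.
have ext f g : periodicC k f -> (forall t : R, f t = g t) -> periodicC k g.
  by move=> fk /funext <-.
move: i; apply: ord4.
- apply: ext (periodicC_lin _ _ _ 1 1 (periodicC_lin _ _ _ 1 (-1) (IH o1) (IH o2)) (ck p o2)) _.
  by move=> t; have [-> _ _ _] := fieldE t (xi t *m v); rewrite /flow; ring.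
- apply: ext (periodicC_lin _ _ _ 1 1 (periodicC_lin _ _ _ (-1) (-1) (IH o0) (IH o3)) (ck q o3)) _.
  by move=> t; have [_ -> _ _] := fieldE t (xi t *m v); rewrite /flow; ring.
- apply: ext (periodicC_lin _ _ _ 1 1 (IH o0) (IH o3)) _.
  by move=> t; have [_ _ -> _] := fieldE t (xi t *m v); rewrite /flow; ring.
- apply: ext (periodicC_lin _ _ _ 1 (-1) (IH o1) (IH o2)) _.
  by move=> t; have [_ _ _ ->] := fieldE t (xi t *m v); rewrite /flow; ring.
Qed.

Let x := flow o2 v.
Let y := flow o3 v.
Let x1 t := 1 * flow o0 v t + 1 * flow o3 v t.
Let y1 t := 1 * flow o1 v t + (-1) * flow o2 v t.

Lemma flow_second_order : exists x2 y2 : R -> R,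
  [/\ primitive x x1 /\ primitive y y1, primitive x1 x2 /\ primitive y1 y2,
      continuous x2 /\ continuous y2,
      forall t, (1 + e * cos t) * (1 * x2 t + (-2) * y1 t) = p * x t &
      forall t, (1 + e * cos t) * (1 * y2 t + 2 * x1 t) = q * y t].
Proof.
have d i := flow_primitive i v.
have cd i : continuous (fun t => field t (xi t *m v) i 0).
  have [_ [f' df [cf _]]] := flow_periodicC 1 i.
  rewrite (_ : (fun t => _) = f')//; apply/funext => t.
  by case: (df t) => _ <-; case: (d i t) => _ <-.
exists (fun t => 1 * field t (xi t *m v) o0 0 + 1 * field t (xi t *m v) o3 0).
exists (fun t => 1 * field t (xi t *m v) o1 0 + (-1) * field t (xi t *m v) o2 0).
have r0 t : (1 + e * cos t) * r t = 1.
  by rewrite /r mulfV// gt_eqF// ellipse_gt0.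
split.
- split=> t; [have := d o2 t|have := d o3 t];
    have [_ _ E2 E3] := fieldE t (xi t *m v); rewrite ?E2 ?E3 /x1 /y1 /flow => ?;
    by apply: is_derive_eq; ring.
- split=> t; have := d o0 t; have := d o1 t; have := d o2 t; have := d o3 t => ? ? ? ?;
    by apply: is_derive_eq.
- by split; apply: continuous_add; exact: continuous_scale.
- move=> t; have [-> _ _ ->] := fieldE t (xi t *m v); rewrite /y1 /x /flow.
  transitivity ((1 + e * cos t) * r t * (p * (xi t *m v) o2 0)); first by ring.
  by rewrite r0 mul1r.
- move=> t; have [_ -> -> _] := fieldE t (xi t *m v); rewrite /x1 /y /flow.
  transitivity ((1 + e * cos t) * r t * (q * (xi t *m v) o3 0)); first by ring.
  by rewrite r0 mul1r.
Qed.

End Periodic.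

(** * Conjugation on the space of periodic solutions *)

Let fcoef_eq (f g : R -> R) b n : continuous f -> continuous g ->
  (forall t, 0 <= t <= 2 * pi -> f t = g t) -> fcoef b f n = fcoef b g n.
Proof.
move=> cf cg fg; apply/eqP; rewrite -subr_eq0 -normr_le0.
have := fcoef_lin b 1 (-1) f g n cf cg; rewrite mul1r mulN1r => <-.
rewrite -[leRHS](mulr0 (2 * pi)); apply: fcoef_bound.
  by apply: continuous_add; exact: continuous_scale.
by move=> t /fg ->; rewrite mul1r mulN1r subrr normr0.
Qed.

(** Only [x] and [y] are compared; the momenta follow from them by differentiation. *)
Let conj_flow v w :=
  conjugate (flow o2 v) (flow o2 w) /\ conjugate (flow o3 v) (flow o3 w).

Let flow_continuous i v : continuous (flow i v).
Proof. exact: primitive_continuous (flow_primitive i v). Qed.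

Let per_lin (f g : R -> R) (a c : R) : f (2 * pi) = f 0 -> g (2 * pi) = g 0 ->
  a * f (2 * pi) + c * g (2 * pi) = a * f 0 + c * g 0.
Proof. by move=> -> ->. Qed.

Lemma ex_conj_flow v : p != 0 -> q != 0 -> xi (2 * pi) *m v = v ->
  exists2 w, xi (2 * pi) *m w = w & conj_flow v w.
Proof.
move=> p0 q0 vper.
have fper i : flow i v (2 * pi) = flow i v 0.
  by have [_ ->] := flow_periodicC v vper 0 i.
have [x2 [y2 [[dx dy] [dx1 dy1] [cx2 cy2] Ex Ey]]] := flow_second_order v vper.
have x10 := per_lin _ _ 1 1 (fper o0) (fper o3).
have y10 := per_lin _ _ 1 (-1) (fper o1) (fper o2).
set x1 := (fun t : R => _) in dx dx1 Ey; set y1 := (fun t : R => _) in dy dy1 Ex.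
pose u t := 1 * x2 t + (-2) * y1 t; pose z t := 1 * y2 t + 2 * x1 t.
(* The prescribed integrals of [X] and [Y] solve the frequency-0 equations, by division by [p] and
   [q]. *)
have [X [X1 [X2 [dX dX1 cX2 [X0 X10] [IX FX]]]]] :=
  ex_conjugate (flow o2 v) (- e * fcoef true u 1 / p) (flow_periodicC v vper 4 o2).
have [Y [Y1 [Y2 [dY dY1 cY2 [Y0 Y10] [IY FY]]]]] :=
  ex_conjugate (flow o3 v) (- e * fcoef true z 1 / q) (flow_periodicC v vper 4 o3).
have eqX t : 0 < t < 2 * pi -> (1 + e * cos t) * (1 * X2 t + (-2) * Y1 t) = p * X t.
  apply: (conjugate_residual e p u (flow o2 v) (fun t => 1 * X2 t + (-2) * Y1 t) X) => //.
  - exact: second_order_continuous cx2 dy1.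
  - exact: second_order_continuous cX2 dY1.
  - exact: primitive_continuous dX.
  - exact: (fcoef_second_order0 dx dx1 cx2 dy dy1 (fper o2) x10 (fper o3)).
  - exact: (fcoef_second_order0 dX dX1 cX2 dY dY1 X0 X10 Y0).
  - exact: (conjugate_second_order dx dx1 cx2 dy dy1 (fper o2) x10 (fper o3)
      dX dX1 cX2 dY dY1 X0 X10 Y0 FX FY).
  - by rewrite IX mulrC divfK.
have eqY t : 0 < t < 2 * pi -> (1 + e * cos t) * (1 * Y2 t + 2 * X1 t) = q * Y t.
  apply: (conjugate_residual e q z (flow o3 v) (fun t => 1 * Y2 t + 2 * X1 t) Y) => //.
  - exact: second_order_continuous cy2 dx1.
  - exact: second_order_continuous cY2 dX1.
  - exact: primitive_continuous dY.
  - exact: (fcoef_second_order0 dy dy1 cy2 dx dx1 (fper o3) y10 (fper o2)).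
  - exact: (fcoef_second_order0 dY dY1 cY2 dX dX1 Y0 Y10 X0).
  - exact: (conjugate_second_order dy dy1 cy2 dx dx1 (fper o3) y10 (fper o2)
      dY dY1 cY2 dX dX1 Y0 Y10 X0 FY FX).
  - by rewrite IY mulrC divfK.
(* The momenta are rebuilt as [X' - Y] and [Y' + X]. *)
pose Z t : 'cV[R]_4 := \col_i match nat_of_ord i with
  | 0%N => 1 * X1 t + (-1) * Y t | 1%N => 1 * Y1 t + 1 * X t | 2%N => X t | _ => Y t end.
have Z0 t : Z t o0 0 = 1 * X1 t + (-1) * Y t by rewrite mxE.
have Z1 t : Z t o1 0 = 1 * Y1 t + 1 * X t by rewrite mxE.
have Z2 t : Z t o2 0 = X t by rewrite mxE.
have Z3 t : Z t o3 0 = Y t by rewrite mxE.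
have cX := primitive_continuous dX; have cX1 := primitive_continuous dX1.
have cY := primitive_continuous dY; have cY1 := primitive_continuous dY1.
have cZ i : continuous (fun t => Z t i 0).
  move: i; apply: ord4.
  - by under eq_fun do rewrite Z0; apply: continuous_add; exact: continuous_scale.
  - by under eq_fun do rewrite Z1; apply: continuous_add; exact: continuous_scale.
  - by under eq_fun do rewrite Z2.
  - by under eq_fun do rewrite Z3.
have dZ t i : 0 < t < 2 * pi ->
    is_derive t (1 : R) (fun s => Z s i 0) ((Jmx R *m Bmx alpha beta e t *m Z t) i 0).
  move=> ht; have r0 : 1 + e * cos t != 0 by rewrite gt_eqF// ellipse_gt0.
  have EX : 1 * X2 t + (-2) * Y1 t = p * r t * X t.
    by apply: (mulfI r0); rewrite eqX// /r; field.
  have EY : 1 * Y2 t + 2 * X1 t = q * r t * Y t.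
    by apply: (mulfI r0); rewrite eqY// /r; field.
  have := dX t; have := dX1 t; have := dY t; have := dY1 t => ? ? ? ?.
  have [F0 F1 F2 F3] := fieldE t (Z t); rewrite /field Z0 Z1 Z2 Z3 in F0 F1 F2 F3.
  move: i; apply: ord4.
  - rewrite F0; under eq_fun do rewrite Z0.
    by apply: is_derive_eq; rewrite /GRing.scale/=; lra.
  - rewrite F1; under eq_fun do rewrite Z1.
    by apply: is_derive_eq; rewrite /GRing.scale/=; lra.
  - rewrite F2; under eq_fun do rewrite Z2.
    by apply: is_derive_eq; rewrite /GRing.scale/=; lra.
  - rewrite F3; under eq_fun do rewrite Z3.
    by apply: is_derive_eq; rewrite /GRing.scale/=; lra.
have ZE T : 0 <= T <= 2 * pi -> Z T = xi T *m Z 0.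
  move=> /andP[T0 T2]; apply: solution_unique => // t i /andP[t0 tT].
  by apply: dZ; rewrite t0 (lt_le_trans tT).
have pi0 := pi_ge0 R.
exists (Z 0).
  rewrite -ZE; last by rewrite lexx mulr_ge0.
  by apply/colP; apply: ord4; rewrite ?(Z0, Z1, Z2, Z3) ?X0 ?X10 ?Y0 ?Y10.
split=> b n; rewrite -?FX -?FY; apply: fcoef_eq => // t ht; rewrite /flow -ZE//.
Qed.

Lemma conj_flow_eq0 w : p != 0 -> q != 0 -> xi (2 * pi) *m w = w ->
  conj_flow 0 w -> w = 0.
Proof.
move=> p0 q0 wper [Cx Cy].
have fper i : flow i w (2 * pi) = flow i w 0.
  by have [_ ->] := flow_periodicC w wper 0 i.
have flow0 i : flow i 0 = fun=> 0.
  by apply/funext => t; rewrite /flow mulmx0 mxE.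
have [x2 [y2 [[dx dy] [dx1 dy1] [cx2 cy2] Ex Ey]]] := flow_second_order w wper.
have x10 := per_lin _ _ 1 1 (fper o0) (fper o3).
have y10 := per_lin _ _ 1 (-1) (fper o1) (fper o2).
set x1 := (fun t : R => _) in dx dx1 Ey; set y1 := (fun t : R => _) in dy dy1 Ex.
have cx0 b n : fcoef b (flow o2 w) n.+1 = 0 by rewrite Cx flow0 fcoef0 mulr0.
have cy0 b n : fcoef b (flow o3 w) n.+1 = 0 by rewrite Cy flow0 fcoef0 mulr0.
have x_eq0 : forall t, 0 < t < 2 * pi -> flow o2 w t = 0.
  apply: (residual_zero _ _ _ _ p0 _ _ _ Ex _ cx0) => //.
  - exact: second_order_continuous cx2 dy1.
  - exact: (fcoef_second_order0 dx dx1 cx2 dy dy1 (fper o2) x10 (fper o3)).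
  - move=> b n; rewrite (fcoef_second_order dx dx1 cx2 dy dy1)//.
    by rewrite cx0 cy0; ring.
have y_eq0 : forall t, 0 < t < 2 * pi -> flow o3 w t = 0.
  apply: (residual_zero _ _ _ _ q0 _ _ _ Ey _ cy0) => //.
  - exact: second_order_continuous cy2 dx1.
  - exact: (fcoef_second_order0 dy dy1 cy2 dx dx1 (fper o3) y10 (fper o2)).
  - move=> b n; rewrite (fcoef_second_order dy dy1 cy2 dx dx1)//.
    by rewrite cx0 cy0; ring.
have pi0 := pi_gt0 R.
have piI : 0 < (pi : R) < 2 * pi by lra.
(* At the interior point [pi], both [x], [y] and their derivatives vanish, hence the whole state;
   injectivity of [xi pi] then gives [w = 0]. *)
have deriv_eq0 (f f' : R -> R) : primitive f f' ->
    (forall t, 0 < t < 2 * pi -> f t = 0) -> f' pi = 0.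
  move=> df f0; case: (df pi) => _ <-.
  rewrite (@near_eq_derive _ _ _ _ (fun=> 0)) ?derive_cst//.
  near=> t; apply: f0; apply/andP; split; near: t.
    by apply: lt_nbhsr; lra.
  by apply: lt_nbhsl; lra.
have z0 := deriv_eq0 _ _ dx x_eq0; have z1 := deriv_eq0 _ _ dy y_eq0.
have z2 := x_eq0 _ piI; have z3 := y_eq0 _ piI.
rewrite /x1 /y1 /flow in z0 z1 z2 z3.
apply: (fundamental_solution_inj pi); first exact: ltW.
by apply/colP; apply: ord4; rewrite [RHS]mxE; lra.
Unshelve. all: by end_near. Qed.

Lemma nu1_even : p != 0 -> q != 0 -> ~~ odd (nu1 (xi (2 * pi))).
Proof.
move=> p0 q0; set M := xi (2 * pi).
have kerE (u : 'rV[R]_4) : (u <= kermx (M - 1%:M)^T)%MS <-> M *m u^T = u^T.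
  split=> [/sub_kermxP E|E]; [apply/eqP|apply/sub_kermxP; apply: trmx_inj].
    by rewrite -subr_eq0 -{2}[u^T]mul1mx -mulmxBl -[M - _]trmxK -trmx_mul E trmx0.
  by rewrite trmx_mul trmxK mulmxBl E mul1mx subrr trmx0.
have flow_lin i c (u w : 'cV[R]_4) :
    flow i (c *: u + w) = (fun t => c * flow i u t + 1 * flow i w t).
  by apply/funext => t; rewrite /flow mulmxDr -scalemxAr !mxE mul1r.
(* The kernel is made of row vectors, hence the transposes. *)
apply: (even_rank R _ _ (kermx (M - 1%:M)^T) (fun u w : 'rV[R]_4 => conj_flow u^T w^T)).
- move=> u /kerE/(ex_conj_flow _ p0 q0)[w wper uw].
  by exists w^T; [apply/kerE|]; rewrite trmxK.
- move=> c u w u' w' _ _ _ _ [h2 h3] [h2' h3'].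
  by rewrite !linearP /=; split; rewrite !flow_lin; exact: conjugate_lin.
- move=> u w _ _ [h2 h3].
  have E i : flow i (- u)^T = (fun t => -1 * flow i u^T t).
    by apply/funext => t; rewrite /flow linearN /= mulmxN mxE mulN1r.
  by split; rewrite E; apply: conjugate_sym.
- move=> w /kerE wper; rewrite trmx0 => w0.
  by apply: trmx_inj; rewrite trmx0; exact: conj_flow_eq0.
Qed.

End Flow.

Theorem theorem7p3 (R : realType) (alpha beta e : R) (xi : R -> 'M[R]_4) :
  R_NH (alpha - beta) (- alpha + 3 * beta - 1) e \/
  R_EH (alpha - beta) (- alpha + 3 * beta - 1) e ->
  fundamental_solution alpha beta e xi ->
  ~~ odd (nu1 (xi (2 * pi))).
Proof.
move=> H xiP; have [e0 e1] : 0 <= e /\ e < 1 by case: H => [[? [? [? ?]]]|[? [? ?]]].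
(* In terms of the region parameters [ta] and [tb], [q = - tb] and [p = 3 + 3 * ta + 2 * tb]; the
   latter is positive since [tb > -1] and [ta > 0]. *)
by apply: (nu1_even _ _ _ _ e0 e1 xiP); case: H => [[? [? [? ?]]]|[? [? ?]]]; lra.
Qed.
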